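(* Let $M\subset\mathbb{R}^{3,1}$ be a spacelike surface with a canonical normal null direction $Z$, where $Z$ is a unit spacelike parallel vector field on $\mathbb{R}^{3,1}$. At every point of $M$, $Z^\top$ is an asymptotic direction. Moreover, $W$ is an asymptotic direction (at every point of $M$) if and only if $M$ has flat normal bundle (i.e. $K_N=0$ on $M$).
   Context: $\mathbb{R}^{3,1}$ is $\mathbb{R}^4$ with the metric $\langle\cdot,\cdot\rangle=dx_1^2+dx_2^2+dx_3^2-dx_4^2$, oriented by the canonical basis. A smooth surface $M\subset\mathbb{R}^{3,1}$ is spacelike if the induced metric is Riemannian. For a parallel (i.e. constant) vector field $Z$ write $Z=Z^\top+Z^\perp$ for its tangent and normal parts along $M$. $M$ has a canonical normal null direction with respect to $Z$ if $Z^\perp$ is a lightlike (nonzero, $\langle Z^\perp,Z^\perp\rangle=0$) normal vector field on $M$. Since $\langle Z,Z\rangle=1$, $|Z^\top|=1$. $B(X,Y)=\overline\nabla_XY-\nabla_XY$ is the second fundamental form ($\overline\nabla$, $\nabla$ the Levi-Civita connections of $\mathbb{R}^{3,1}$ and $M$), and $\langle A_\nu X,Y\rangle=\langle B(X,Y),\nu\rangle$. $W$ is the unit tangent vector field orthogonal to $Z^\top$ with $(Z^\top,W)$ positively oriented, $W'$ is the lightlike normal field with $\langle Z^\perp,W'\rangle=1$, and the orientation of $M$ is such that $(Z^\top,W,e_3,e_4)$ with $e_3=\frac{Z^\perp+W'}{\sqrt2}$, $e_4=\frac{Z^\perp-W'}{\sqrt2}$ is a positively oriented orthonormal frame of $\mathbb{R}^{3,1}$.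 The normal curvature is $K_N=\langle(A_{e_3}A_{e_4}-A_{e_4}A_{e_3})(Z^\top),W\rangle$. The Gauss map is $G:M\to\Lambda^2\mathbb{R}^{3,1}$, $G(p)=u_1\wedge u_2$ for $(u_1,u_2)$ an oriented orthonormal basis of $T_pM$; so $G=Z^\top\wedge W$. For $p\in M$ define the real quadratic form $\delta:T_pM\to\mathbb{R}$, $\delta(u)=dG_p(u)\wedge dG_p(u)$, where $\Lambda^4\mathbb{R}^{3,1}\simeq\mathbb{R}$ via the canonical volume element $\simeq 1$ (the wedge of any positively oriented orthonormal basis). A nonzero $u\in T_pM$ defines an asymptotic direction at $p$ if $\delta(u)=0$. *)

(* Defs.v *)
From HB Require Import structures.
From mathcomp Require Import all_boot all_order all_algebra.
From mathcomp Require Import all_classical all_reals all_analysis.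
From mathcomp Require Import ring.

Set Implicit Arguments.
Unset Strict Implicit.
Unset Printing Implicit Defensive.

Import Order.TTheory GRing.Theory Num.Theory.
Import numFieldNormedType.Exports.

Local Open Scope classical_set_scope.
Local Open Scope ring_scope.

Section MultilinearAlgebra.
Context {R : realType}.

(* The coordinates x_1, ..., x_4 have indices 0, ..., 3 in 'I_4. *)
Definition mink (u v : 'rV[R]_4) : R :=
  u 0 0 * v 0 0 + u 0 1 * v 0 1 + u 0 2 * v 0 2 - u 0 3 * v 0 3.

Definition frame_mx (u1 u2 u3 u4 : 'rV[R]_4) : 'M[R]_4 :=
  \matrix_(i < 4) tnth [tuple u1; u2; u3; u4] i.

Definition positive_frame (u1 u2 u3 u4 : 'rV[R]_4) : Prop :=
  0 < \det (frame_mx u1 u2 u3 u4).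

(* Bivectors are represented by skew-symmetric matrices: the (i, j) entry is
   the coefficient of e_i /\ e_j for i < j. *)
Definition wedge (u v : 'rV[R]_4) : 'M[R]_4 := u^T *m v - v^T *m u.

(* The exterior product of two bivectors, as the coefficient of
   e_1 /\ e_2 /\ e_3 /\ e_4. *)
Definition wedge4 (a b : 'M[R]_4) : R :=
  a 0 1 * b 2 3 - a 0 2 * b 1 3 + a 0 3 * b 1 2
  + a 1 2 * b 0 3 - a 1 3 * b 0 2 + a 2 3 * b 0 1.

Lemma det_mx33 (f : nat -> nat -> R) :
  \det (\matrix_(i < 3, j < 3) f i j) =
    f 0 0 * (f 1 1 * f 2 2 - f 1 2 * f 2 1)
    - f 0 1 * (f 1 0 * f 2 2 - f 1 2 * f 2 0)
    + f 0 2 * (f 1 0 * f 2 1 - f 1 1 * f 2 0).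
Proof.
do 3 rewrite !(expand_det_row _ ord0) !big_ord_recl !big_ord0 /cofactor.
rewrite !det_mx00 !mxE /= /bump /=.
ring.
Qed.

Lemma det_mx44 (f : nat -> nat -> R) :
  \det (\matrix_(i < 4, j < 4) f i j) =
    \sum_(j < 4) f 0 j *
      ((-1) ^+ j * \det (\matrix_(i < 3, k < 3) f i.+1 (bump j k))).
Proof.
rewrite (expand_det_row _ ord0); apply: eq_bigr => j _.
rewrite mxE /cofactor add0n; congr (_ * (_ * \det _)).
by apply/matrixP=> i k; rewrite !mxE.
Qed.

Lemma wedge4_wedge (u1 u2 u3 u4 : 'rV[R]_4) :
  wedge4 (wedge u1 u2) (wedge u3 u4) = \det (frame_mx u1 u2 u3 u4).
Proof.
pose f i j := (tnth [tuple u1; u2; u3; u4] (inord i)) 0 (inord j).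
have -> : frame_mx u1 u2 u3 u4 = \matrix_(i < 4, j < 4) f i j.
  by apply/matrixP=> i j; rewrite !mxE /f !inord_val.
rewrite det_mx44 !big_ord_recl big_ord0.
rewrite !(det_mx33 (fun i k => f i.+1 (bump _ k))) /= /bump /=.
have W u v i j : wedge u v i j = u 0 i * v 0 j - v 0 i * u 0 j.
  by rewrite !mxE !big_ord_recl !big_ord0 !mxE !addr0.
rewrite /wedge4 !W /f !(tnth_nth 0) !inordK //=.
have -> : inord 0 = 0 :> 'I_4 by apply/val_inj; rewrite /= inordK.
have -> : inord 1 = 1 :> 'I_4 by apply/val_inj; rewrite /= inordK.
have -> : inord 2 = 2 :> 'I_4 by apply/val_inj; rewrite /= inordK.
have -> : inord 3 = 3 :> 'I_4 by apply/val_inj; rewrite /= inordK.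
ring.
Qed.

End MultilinearAlgebra.

Section Smoothness.
Context {R : realType} {V W : normedModType R}.

Fixpoint ck (k : nat) (O : set V) (f : V -> W) : Prop :=
  match k with
  | 0 => forall x, O x -> {for x, continuous f}
  | k'.+1 => (forall x, O x -> differentiable f x)
             /\ forall v : V, ck k' O (fun x => 'D_v f x)
  end.

(* f is C^oo on O, which is meant to be open. *)
Definition smooth (O : set V) (f : V -> W) : Prop := forall k, ck k O f.

End Smoothness.

Section Surfaces.
Context {R : realType}.
Implicit Types (M : set 'rV[R]_4) (X Y : 'rV[R]_4 -> 'rV[R]_4).

(* phi is a diffeomorphism from the open set U of the plane onto a relatively
   open part of M, with inverse the restriction of the smooth map psi. *)
Definition local_param M (U : set 'rV[R]_2) (phi : 'rV[R]_2 -> 'rV[R]_4) :=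
  [/\ open U, smooth U phi &
    exists (O : set 'rV[R]_4) (psi : 'rV[R]_4 -> 'rV[R]_2),
      [/\ open O, smooth O psi, phi @` U = M `&` O &
          forall q, U q -> psi (phi q) = q]].

Definition smooth_surface M : Prop :=
  forall p, M p -> exists U phi q, [/\ local_param M U phi, U q & phi q = p].

Definition tangent_vec M (p u : 'rV[R]_4) : Prop :=
  exists U phi q (a : 'rV[R]_2),
    [/\ local_param M U phi, U q, phi q = p & 'd phi q a = u].

Definition normal_vec M (p n : 'rV[R]_4) : Prop :=
  forall u, tangent_vec M p u -> mink u n = 0.

Definition spacelike M : Prop :=
  forall p u, M p -> tangent_vec M p u -> u != 0 -> 0 < mink u u.

Definition tangent_basis M (p u1 u2 : 'rV[R]_4) : Prop :=
  (forall a b : R, a *: u1 + b *: u2 = 0 -> a = 0 /\ b = 0)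
  /\ forall v, tangent_vec M p v <-> exists a b : R, v = a *: u1 + b *: u2.

(* Functions on M are functions on the ambient space of which only the
   values on M matter. They are smooth when they have local smooth extensions,
   and the differential along a tangent vector is that of an extension. *)
Definition smooth_on {V : normedModType R} M (f : 'rV[R]_4 -> V) : Prop :=
  forall p, M p -> exists (O : set 'rV[R]_4) (F : 'rV[R]_4 -> V),
    [/\ open O, O p, smooth O F & forall x, O x -> M x -> F x = f x].

Definition mdiff {V : normedModType R} M (f : 'rV[R]_4 -> V)
    (p u : 'rV[R]_4) : V :=
  get [set w | exists F : 'rV[R]_4 -> V,
    [/\ differentiable F p, (\forall x \near p, M x -> F x = f x)
      & w = 'd F p u]].

Definition tangent_field M X : Prop :=
  smooth_on M X /\ forall p, M p -> tangent_vec M p (X p).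

Definition normal_field M X : Prop :=
  smooth_on M X /\ forall p, M p -> normal_vec M p (X p).

(* pos p u1 u2 means that (u1, u2) is a positive basis of the tangent plane
   at p. *)
Definition orientation M
    (pos : 'rV[R]_4 -> 'rV[R]_4 -> 'rV[R]_4 -> Prop) : Prop :=
  [/\ forall p u1 u2, M p -> pos p u1 u2 -> tangent_basis M p u1 u2,
      forall p u1 u2 (a b c d : R), M p -> pos p u1 u2 ->
        (pos p (a *: u1 + b *: u2) (c *: u1 + d *: u2) <-> 0 < a * d - b * c)
    & forall p, M p -> exists U phi,
        [/\ local_param M U phi, (phi @` U) p & forall q, U q ->
          pos (phi q) ('d phi q (delta_mx 0 0)) ('d phi q (delta_mx 0 1))]].

(* The derivative of the real function f in the direction of X. *)
Definition lie M X (f : 'rV[R]_4 -> R^o) : 'rV[R]_4 -> R^o :=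
  fun p => mdiff M f p (X p).

(* The Levi-Civita connection of the induced metric: a connection that is
   metric and torsion-free, [X, Y] being the commutator of derivations. *)
Definition levi_civita M
    (nabla : ('rV[R]_4 -> 'rV[R]_4) -> ('rV[R]_4 -> 'rV[R]_4) ->
             'rV[R]_4 -> 'rV[R]_4) : Prop :=
  [/\ forall X Y, tangent_field M X -> tangent_field M Y ->
        tangent_field M (nabla X Y),
      forall (f : 'rV[R]_4 -> R^o) X X' Y p,
        smooth_on M f -> tangent_field M X -> tangent_field M X' ->
        tangent_field M Y -> M p ->
        nabla (fun x => (f x : R) *: X x + X' x) Y p
          = (f p : R) *: nabla X Y p + nabla X' Y p,
      forall (f : 'rV[R]_4 -> R^o) X Y Y' p,
        smooth_on M f -> tangent_field M X -> tangent_field M Y ->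
        tangent_field M Y' -> M p ->
        nabla X (fun x => (f x : R) *: Y x + Y' x) p
          = (lie M X f p : R) *: Y p + (f p : R) *: nabla X Y p
            + nabla X Y' p,
      forall X Y Y' p,
        tangent_field M X -> tangent_field M Y -> tangent_field M Y' -> M p ->
        lie M X (fun x => mink (Y x) (Y' x)) p
          = mink (nabla X Y p) (Y' p) + mink (Y p) (nabla X Y' p)
    & forall X Y (f : 'rV[R]_4 -> R^o) p,
        tangent_field M X -> tangent_field M Y -> smooth_on M f -> M p ->
        lie M (nabla X Y) f p - lie M (nabla Y X) f p
          = lie M X (lie M Y f) p - lie M Y (lie M X f) p].

(* The Levi-Civita connection of the flat metric is the componentwise
   derivative. *)
Definition flat_nabla M X Y : 'rV[R]_4 -> 'rV[R]_4 :=
  fun p => mdiff M Y p (X p).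

Definition second_form M nabla X Y : 'rV[R]_4 -> 'rV[R]_4 :=
  fun p => flat_nabla M X Y p - nabla X Y p.

Definition shape_operator M nabla
    (A : ('rV[R]_4 -> 'rV[R]_4) -> ('rV[R]_4 -> 'rV[R]_4) ->
         'rV[R]_4 -> 'rV[R]_4) : Prop :=
  forall nu X, normal_field M nu -> tangent_field M X ->
    tangent_field M (A nu X)
    /\ forall Y p, tangent_field M Y -> M p ->
         mink (A nu X p) (Y p) = mink (second_form M nabla X Y p) (nu p).

(* Zt and Zn are the tangent and normal parts along M of the parallel field
   with constant value z. *)
Definition parallel_parts M (z : 'rV[R]_4) Zt Zn : Prop :=
  [/\ tangent_field M Zt, normal_field M Zn &
      forall p, M p -> z = Zt p + Zn p].

Definition lightlike_normal M N : Prop :=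
  normal_field M N /\ forall p, M p -> N p != 0 /\ mink (N p) (N p) = 0.

Definition e3 (Zn W' : 'rV[R]_4 -> 'rV[R]_4) : 'rV[R]_4 -> 'rV[R]_4 :=
  fun p => (Num.sqrt 2)^-1 *: (Zn p + W' p).

Definition e4 (Zn W' : 'rV[R]_4 -> 'rV[R]_4) : 'rV[R]_4 -> 'rV[R]_4 :=
  fun p => (Num.sqrt 2)^-1 *: (Zn p - W' p).

Definition normal_curvature
    (A : ('rV[R]_4 -> 'rV[R]_4) -> ('rV[R]_4 -> 'rV[R]_4) ->
         'rV[R]_4 -> 'rV[R]_4)
    (Zt Zn W W' : 'rV[R]_4 -> 'rV[R]_4) (p : 'rV[R]_4) : R :=
  mink (A (e3 Zn W') (A (e4 Zn W') Zt) p - A (e4 Zn W') (A (e3 Zn W') Zt) p)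
       (W p).

Definition gauss_map M pos (G : 'rV[R]_4 -> 'M[R]_4) : Prop :=
  forall p, M p -> exists u1 u2,
    [/\ pos p u1 u2, mink u1 u1 = 1, mink u2 u2 = 1, mink u1 u2 = 0 &
        G p = wedge u1 u2].

Definition delta M (G : 'rV[R]_4 -> 'M[R]_4) (p u : 'rV[R]_4) : R :=
  wedge4 (mdiff M G p u) (mdiff M G p u).

Definition asymptotic M G (p u : 'rV[R]_4) : Prop :=
  [/\ tangent_vec M p u, u != 0 & delta M G p u = 0].

End Surfaces.

(* Main.v *)
From HB Require Import structures.
Require Import Defs.
From mathcomp Require Import all_boot all_order all_algebra.
From mathcomp Require Import all_classical all_reals all_analysis.
From mathcomp Require Import ring.
Import Order.TTheory GRing.Theory Num.Theory.
Import numFieldNormedType.Exports.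
Local Open Scope classical_set_scope.
Local Open Scope ring_scope.
Set Implicit Arguments.
Unset Strict Implicit.
Unset Printing Implicit Defensive.

(** Write X for the tangent part of z, n for its normal part, m for the second
    null normal, and D_u for the componentwise derivative along a tangent
    vector u. The proof compares two computations in the null frame
    (X, W, n, m).

    The asymptotic form. On M the Gauss map is X /\ W, so the product rule gives
    delta(u) = -2 X /\ W /\ D_u X /\ D_u W. Only the normal components of D_u X
    and D_u W contribute, and a Gram determinant reads them off: up to a nonzero
    factor, delta(u) is <D_u X, m> <D_u W, n> - <D_u X, n> <D_u W, m>
    (delta_null_frame). Since z is constant, D_u X = - D_u n, and since n is null,
    <D_u n, n> = 0; hence the second product vanishes and delta(u) = 0 if and
    only if <D_u X, m> <D_u W, n> = 0.

    For u = X, the symmetry of the second fundamental form (second_form_sym) turns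
    <D_X W, n> into <D_W X, n> = 0, so X is asymptotic.

    The normal curvature. The commutator of the shape operators along
    (n + m) / sqrt 2 and (n - m) / sqrt 2 is that of A_m and A_n. As A_n X = 0,
    normal_curvature_null_frame gives
    K_N = - <D_X W, m> <D_W W, n> = - <D_W X, m> <D_W W, n>.
    This is, up to sign, the product that decides whether delta(W) = 0, so the
    equivalence even holds point by point.

    Functions on M are differentiated through extensions to the ambient space.
    The value along a tangent vector does not depend on the extension because it
    is a derivative along a parametrization (diff_tangent_eq); this makes the
    usual rules of calculus available. The symmetry of the second fundamental
    form comes from the torsion axiom tested on the coordinate functions
    (torsion_free), which spares any computation with second derivatives. *)

(** * Differentiability and smoothness in normed spaces *)

Section Calculus.
Context {R : realType} {V W : normedModType R}.
Implicit Types (f g : V -> W) (x : V).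

(** A function that vanishes near a point is its own remainder of order o(id), so
    the zero map serves as its differential. *)
Lemma near0_differentiable f x : (\near x, f x = 0) -> differentiable f x.
Proof.
move=> f0.
have E : f \o shift x = cst (f x) + (\0 : V -> W) +o_ 0 id.
  apply/eqaddoP => e e0; near=> y => /=.
  rewrite !fctE /= (nbhs_singleton f0) add0r subr0.
  suff -> : f (y + x) = 0 by rewrite normr0 mulr_ge0 // ltW.
  near: y; have := f0; rewrite (near_shift 0).
  by apply: filterS => y /=; rewrite subr0.
apply/diff_locallyP.
have c0 : continuous (\0 : V -> W) by exact: cst_continuous.
have D0 := @diff_unique _ _ _ f \0 x c0 E.
by split; rewrite D0.
Unshelve. all: by end_near. Qed.

Lemma near_differentiable f g x :
  (\near x, f x = g x) -> differentiable f x -> differentiable g x.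
Proof.
move=> fg df; have -> : g = f + (g - f) by rewrite addrC subrK.
apply: differentiableD => //; apply: near0_differentiable.
by apply: filterS fg => y /= e; rewrite !fctE e subrr.
Qed.

Lemma near_diff f g x a : differentiable f x -> differentiable g x ->
  (\near x, f x = g x) -> 'd f x a = 'd g x a.
Proof. by move=> df dg fg; rewrite -!deriveE // (near_eq_derive _ fg). Qed.

(** The derivatives in ck are taken on the whole space, so replacing f by another
    function on O changes them outside O; openness of O makes the change harmless
    at every stage of the recursion. *)
Lemma ck_ext k (O : set V) f g :
  open O -> (forall x, O x -> f x = g x) -> ck k O f -> ck k O g.
Proof.
move=> oO; have nO x : O x -> \near x, O x by move=> Ox; exact: open_nbhs_nbhs.
elim: k f g => [|k IH] f g fg /=.
  move=> cf x Ox; suff : g @ x --> f x by rewrite (fg x Ox).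
  apply: cvg_trans (cf x Ox); apply: near_eq_cvg.
  by apply: filterS (nO x Ox) => y Oy; rewrite fg.
have nfg x : O x -> \near x, f x = g x.
  by move=> Ox; apply: filterS (nO x Ox) => y; exact: fg.
case=> df Df; split=> [x Ox|v]; first exact: near_differentiable (nfg x Ox) (df x Ox).
by apply: IH (Df v) => x Ox; apply: near_eq_derive; exact: nfg.
Qed.

Lemma ck_sub k (O O' : set V) f : O' `<=` O -> ck k O f -> ck k O' f.
Proof.
move=> sO; elim: k f => [|k IH] f /=; first by move=> cf x /sO; exact: cf.
by case=> df Df; split=> [x /sO|v]; [exact: df|exact: IH].
Qed.

Lemma ckD k (O : set V) f g : open O -> ck k O f -> ck k O g -> ck k O (f + g).
Proof.
move=> oO; elim: k f g => [|k IH] f g /=.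
  by move=> cf cg x Ox; apply: continuousD; [exact: cf|exact: cg].
move=> [df Df] [dg Dg]; split=> [x Ox|v].
  by apply: differentiableD; [exact: df|exact: dg].
apply: ck_ext (IH _ _ (Df v) (Dg v)) => // x Ox.
by rewrite deriveD //; apply: diff_derivable; [exact: df|exact: dg].
Qed.

Lemma ckZ k (O : set V) (c : R) f : open O -> ck k O f -> ck k O (c *: f).
Proof.
move=> oO; elim: k f => [|k IH] f /=.
  by move=> cf x Ox; apply: continuousZl_tmp; exact: cf.
move=> [df Df]; split=> [x Ox|v]; first by apply: differentiableZ; exact: df.
apply: ck_ext (IH _ (Df v)) => // x Ox.
by rewrite deriveZ //; apply: diff_derivable; exact: df.
Qed.

Lemma ck_cst k (O : set V) (w : W) : ck k O (fun=> w).
Proof.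
elim: k w => [|k IH] w /=; first by move=> x _; exact: cst_continuous.
split=> [x _|v]; first exact: differentiable_cst.
have -> : (fun x => 'D_v (fun=> w) x) = (fun=> 0).
  by apply/funext => x; exact: derive_cst.
exact: IH.
Qed.

Lemma smooth_linear (O : set V) (f : {linear V -> W}) : continuous f -> smooth O f.
Proof.
move=> cf [|k] /=; first by move=> x _; exact: cf.
split=> [x _|v]; first exact: linear_differentiable.
have -> : (fun x => 'D_v f x) = (fun=> f v).
  by apply/funext => x; rewrite deriveE ?diff_lin //; exact: linear_differentiable.
exact: ck_cst.
Qed.

End Calculus.

(** * Linear and bilinear maps on row vectors *)

Section RowVectors.
Context {R : realType} {V : normedModType R}.

Lemma rV_linear_continuous n (f : {linear 'rV[R]_n -> V}) : continuous f.
Proof.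
have -> : (f : 'rV[R]_n -> V) = fun x => \sum_i x 0 i *: f (delta_mx 0 i).
  apply/funext => x; rewrite {1}(row_sum_delta x) linear_sum.
  by apply: eq_bigr => i _; rewrite linearZ.
apply: continuous_big => [|i _]; first exact: add_continuous.
by move=> x; apply: continuousZr_tmp; exact: coord_continuous.
Qed.

Lemma rV_bilinear_continuous m n (f : {bilinear 'rV[R]_m -> 'rV[R]_n -> V}) :
  continuous (fun p => f p.1 p.2).
Proof.
have -> : (fun p => f p.1 p.2) = fun p => \sum_i p.1 0 i *: f (delta_mx 0 i) p.2.
  apply/funext => -[x y] /=; rewrite {1}(row_sum_delta x) linear_sumlz.
  by apply: eq_bigr => i _; rewrite linearZl_LR.
apply: continuous_big => [|i _]; first exact: add_continuous.
move=> [x y]; apply: cvgZ => /=.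
  apply: (@cvg_comp _ _ _ fst (fun z : 'rV[R]_m => z 0 i) _ (nbhs x)).
    exact: cvg_fst.
  exact: coord_continuous.
apply: (@cvg_comp _ _ _ snd (f (delta_mx 0 i)) _ (nbhs y)); first exact: cvg_snd.
exact: rV_linear_continuous.
Qed.

Lemma diff_bilin_comp {U : normedModType R} m n
    (f : {bilinear 'rV[R]_m -> 'rV[R]_n -> V})
    (F : U -> 'rV[R]_m) (G : U -> 'rV[R]_n) x :
    differentiable F x -> differentiable G x ->
  is_diff x (fun y => f (F y) (G y))
    (fun v => f (F x) ('d G x v) + f ('d F x v) (G x)).
Proof.
move=> dF dG.
pose FG y := (F y, G y).
have dFG : differentiable FG x by exact: differentiable_pair.
have cf := @rV_bilinear_continuous _ _ f.
have df := @differentiable_bilin _ _ _ _ f (FG x) cf.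
split; first exact: (differentiable_comp dFG df).
rewrite (diff_comp dFG df) (diff_bilin (FG x) cf).
by apply/funext => v /=; rewrite diff_pair.
Qed.

End RowVectors.

(** * Minkowski algebra *)

Section Minkowski.
Context {R : realType}.
Implicit Types u v w : 'rV[R]_4.

Lemma minkC u v : mink u v = mink v u.
Proof. by rewrite /mink; ring. Qed.

Lemma minkDl u v w : mink (u + v) w = mink u w + mink v w.
Proof. by rewrite /mink !mxE; ring. Qed.

Lemma minkZl (a : R) u w : mink (a *: u) w = a * mink u w.
Proof. by rewrite /mink !mxE; ring. Qed.

Lemma minkNl u w : mink (- u) w = - mink u w.
Proof. by rewrite /mink !mxE; ring. Qed.

Lemma mink0l w : mink 0 w = 0.
Proof. by rewrite /mink !mxE; ring. Qed.

Lemma minkDr u v w : mink w (u + v) = mink w u + mink w v.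
Proof. by rewrite !(minkC w) minkDl. Qed.

Lemma minkZr (a : R) u w : mink w (a *: u) = a * mink w u.
Proof. by rewrite !(minkC w) minkZl. Qed.

Lemma minkNr u w : mink w (- u) = - mink w u.
Proof. by rewrite !(minkC w) minkNl. Qed.

Lemma mink_is_bilinear :
  bilinear_for (GRing.Scale.Law.clone _ _ *:%R _) (GRing.Scale.Law.clone _ _ *:%R _)
    (@mink R : _ -> _ -> R^o).
Proof.
by split=> [w|u] a x y /=; rewrite ?minkDl ?minkZl ?minkDr ?minkZr.
Qed.
HB.instance Definition _ := bilinear_isBilinear.Build R 'rV[R]_4 'rV[R]_4 R^o
  _ _ (@mink R : _ -> _ -> R^o) mink_is_bilinear.

Lemma wedge_is_bilinear :
  bilinear_for (GRing.Scale.Law.clone _ _ *:%R _) (GRing.Scale.Law.clone _ _ *:%R _)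
    (@wedge R).
Proof.
by split=> [w|u] a x y; apply/matrixP => i j; rewrite !mxE !big_ord1 !mxE /=; ring.
Qed.
HB.instance Definition _ := bilinear_isBilinear.Build R 'rV[R]_4 'rV[R]_4 'M[R]_4
  _ _ (@wedge R) wedge_is_bilinear.

Definition mink_mx : 'M[R]_4 := diag_mx (\row_j (-1) ^+ (j == 3)).

Lemma mink_mxE u v : mink u v = (u *m mink_mx *m v^T) 0 0.
Proof.
rewrite /mink_mx mul_mx_diag mxE !big_ord_recl big_ord0 !mxE /=.
rewrite /mink !expr0 !expr1 !mulr1 !addr0 mulrN1 mulNr !addrA.
by do ![congr (_ + _)]; do ?congr (- _); congr (_ * _); congr (_ 0 _); apply/val_inj.
Qed.

Lemma det_mink_mx : \det mink_mx = -1.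
Proof.
rewrite det_diag !big_ord_recl big_ord0 !mxE /= !expr0 expr1.
by rewrite !mul1r mulr1.
Qed.

(** If A and B have the rows a and b, the matrix on the right is A J B^T, where J is
    the matrix of the metric; the sign is det J = -1. *)
Lemma det_gram (a b : 4.-tuple 'rV[R]_4) :
  \det (\matrix_i tnth a i) * \det (\matrix_i tnth b i)
  = - \det (\matrix_(i, j) mink (tnth a i) (tnth b j)).
Proof.
set A := \matrix_i _; set B := \matrix_i _.
have -> : \matrix_(i, j) mink (tnth a i) (tnth b j) = A *m mink_mx *m B^T.
  apply/matrixP => i j; rewrite !mxE mink_mxE mxE; apply: eq_bigr => k _.
  by rewrite !mxE; congr (_ * _); apply: eq_bigr => l _; rewrite !mxE.
by rewrite !det_mulmx det_tr det_mink_mx mulrN1 mulNr opprK.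
Qed.

(** Both factors on the left are determinants with the same first two rows, so
    their product is a Gram determinant. When x and w are orthonormal and n and m
    are orthogonal to them, this Gram matrix is block triangular, and only the
    products with the normal vectors n and m survive. *)
Lemma wedge4_normal_plane x w n m s t :
    mink x x = 1 -> mink w w = 1 -> mink x w = 0 ->
    mink x n = 0 -> mink x m = 0 -> mink w n = 0 -> mink w m = 0 ->
  wedge4 (wedge x w) (wedge s t) * wedge4 (wedge x w) (wedge n m)
  = mink s m * mink t n - mink s n * mink t m.
Proof.
move=> xx ww xw xn xm wn wm.
rewrite !wedge4_wedge [LHS]det_gram.
pose f i j := mink (nth 0 [:: x; w; s; t] i) (nth 0 [:: x; w; n; m] j).
rewrite [X in \det X](_ : _ = \matrix_(i < 4, j < 4) f i j); last first.
  by apply/matrixP => i j; rewrite !mxE !(tnth_nth 0).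
rewrite det_mx44 !big_ord_recl big_ord0.
rewrite !(det_mx33 (fun i k => f i.+1 (bump _ k))) /= /bump /f /=.
rewrite xx ww (minkC w x) xw xn xm wn wm; ring.
Qed.

Lemma wedgeDD (a b c d : R) u v :
  wedge (a *: u + b *: v) (c *: u + d *: v) = (a * d - b * c) *: wedge u v.
Proof.
by apply/matrixP => i j; rewrite !mxE !big_ord1 !mxE; ring.
Qed.

(** The wedge of x' /\ w with itself is zero, and so is that of x /\ w'; the two
    mixed terms are equal since bivectors commute. *)
Lemma wedge4_sum x w x' w' :
  wedge4 (wedge x' w + wedge x w') (wedge x' w + wedge x w')
  = - (2 * wedge4 (wedge x w) (wedge x' w')).
Proof. by rewrite /wedge4 !mxE !big_ord1 !mxE; ring. Qed.

End Minkowski.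

(** * Differentiation along the surface *)

Section Tangential.
Context {R : realType}.
Implicit Types (M : set 'rV[R]_4) (X Y : 'rV[R]_4 -> 'rV[R]_4).

Definition extends_at {V : normedModType R} M (p : 'rV[R]_4)
    (f F : 'rV[R]_4 -> V) : Prop :=
  differentiable F p /\ \forall x \near p, M x -> F x = f x.

Lemma extends_on {V : normedModType R} M p (f F : 'rV[R]_4 -> V) :
  differentiable F p -> (forall x, M x -> F x = f x) -> extends_at M p f F.
Proof.
by move=> dF Ff; split=> //; near=> x; exact: Ff.
Unshelve. all: by end_near. Qed.

Lemma smooth_on_extends {V : normedModType R} M (f : 'rV[R]_4 -> V) p :
  smooth_on M f -> M p -> exists F, extends_at M p f F.
Proof.
move=> sf /sf [D [F [Dop Dp sF eF]]]; exists F; split.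
  by have [dF _] := sF 1; exact: dF.
have nD : \near p, D p by exact: open_nbhs_nbhs.
by apply: filterS nD => x; exact: eF.
Qed.

(** A tangent vector is the image of a vector a under the differential of a
    parametrization phi, and the differential of F along it is the derivative of
    the composite of F and phi along a. That composite only sees the values of F
    on M, hence any two extensions of a function on M have the same derivative. *)
Lemma diff_tangent_eq {V : normedModType R} M p u (F G : 'rV[R]_4 -> V) :
    tangent_vec M p u -> differentiable F p -> differentiable G p ->
    (\forall x \near p, M x -> F x = G x) -> 'd F p u = 'd G p u.
Proof.
case=> U [phi [q [a [[Uop sphi [D [psi [Dop spsi imphi _]]]] Uq <- <-]]]] dF dG FG.
have dphi : differentiable phi q by have [d _] := sphi 1; exact: d.
have compE H : differentiable H (phi q) ->
    'd H (phi q) ('d phi q a) = 'd (H \o phi) q a :> V.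
  by move=> dH; rewrite (@diff_comp _ _ _ _ phi H q dphi dH).
rewrite (compE F dF) (compE G dG).
apply: near_diff; [exact: differentiable_comp..|].
have nU : \near q, U q by exact: open_nbhs_nbhs.
have cFG := differentiable_continuous dphi FG.
near=> y => /=.
have Uy : U y by near: y.
have My : M (phi y).
  have : (M `&` D) (phi y) by rewrite -imphi; exists y.
  by case.
by move: My; near: y.
Unshelve. all: by end_near. Qed.

Lemma mdiffE {V : normedModType R} M (f F : 'rV[R]_4 -> V) p u :
  tangent_vec M p u -> extends_at M p f F -> mdiff M f p u = 'd F p u.
Proof.
move=> tu [dF eF]; rewrite /mdiff.
have [|H [dH eH ->]] := @getPex _ [set w | exists F : 'rV[R]_4 -> V,
    [/\ differentiable F p, (\forall x \near p, M x -> F x = f x)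
      & w = 'd F p u]]; first by exists ('d F p u), F.
apply: diff_tangent_eq tu dH dF _.
by apply: filterS2 eF eH => x eF eH Mx; rewrite eF ?eH.
Qed.

Lemma mdiff_eq_on {V : normedModType R} M (f g : 'rV[R]_4 -> V) p u :
  (forall x, M x -> f x = g x) -> mdiff M f p u = mdiff M g p u.
Proof.
move=> fg; rewrite /mdiff; congr get.
by apply/seteqP; split=> w [F [dF eF ->]]; exists F; split=> //;
  apply: filterS eF => x eF Mx; rewrite eF ?fg.
Qed.

(** The case of interest is c = z, with f and g its tangent and normal parts. *)
Lemma mdiffN_cst {V : normedModType R} M (f g : 'rV[R]_4 -> V) c p u :
    smooth_on M f -> M p -> tangent_vec M p u ->
    (forall x, M x -> c = f x + g x) ->
  mdiff M g p u = - mdiff M f p u.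
Proof.
move=> sf Mp tu fg; have [F [dF eF]] := smooth_on_extends sf Mp.
have eG : extends_at M p g (cst c - F).
  split; first exact: differentiableB.
  by apply: filterS eF => x eF Mx; rewrite !fctE eF // (fg x Mx) addrC addKr.
by rewrite (mdiffE tu eG) (mdiffE tu (conj dF eF)) (diffB (differentiable_cst c p) dF) diff_cst /= sub0r.
Qed.

Lemma mdiff_lin {V : normedModType R} M (f : 'rV[R]_4 -> V) p u v (a b : R) :
    smooth_on M f -> M p -> tangent_vec M p u -> tangent_vec M p v ->
    tangent_vec M p (a *: u + b *: v) ->
  mdiff M f p (a *: u + b *: v) = a *: mdiff M f p u + b *: mdiff M f p v.
Proof.
move=> sf Mp tu tv tuv; have [F eF] := smooth_on_extends sf Mp.
by rewrite !(mdiffE _ eF) // linearD !linearZ.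
Qed.

Lemma mdiff_linear {V : normedModType R} (l : {linear 'rV[R]_4 -> V}) M X p u :
    smooth_on M X -> M p -> tangent_vec M p u ->
  mdiff M (fun x => l (X x)) p u = l (mdiff M X p u).
Proof.
move=> sX Mp tu; have [F eF] := smooth_on_extends sX Mp.
have dl := @linear_differentiable _ _ _ l (F p) (@rV_linear_continuous _ _ _ l).
have e : extends_at M p (fun x => l (X x)) (l \o F).
  have [dF FX] := eF; split; first exact: differentiable_comp.
  by apply: filterS FX => x FX Mx /=; rewrite FX.
rewrite (mdiffE tu e) (mdiffE tu eF) (diff_comp (proj1 eF) dl) /=.
by rewrite diff_lin //; exact: rV_linear_continuous.
Qed.

Lemma mdiff_bilinear {V : normedModType R}
    (b : {bilinear 'rV[R]_4 -> 'rV[R]_4 -> V}) M X Y p u :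
    smooth_on M X -> smooth_on M Y -> M p -> tangent_vec M p u ->
  mdiff M (fun x => b (X x) (Y x)) p u
    = b (X p) (mdiff M Y p u) + b (mdiff M X p u) (Y p).
Proof.
move=> sX sY Mp tu.
have [F eF] := smooth_on_extends sX Mp; have [dF FX] := eF.
have [G eG] := smooth_on_extends sY Mp; have [dG GY] := eG.
have D := diff_bilin_comp b dF dG.
have e : extends_at M p (fun x => b (X x) (Y x)) (fun x => b (F x) (G x)).
  by split; [exact: ex_diff|apply: filterS2 FX GY => x FX GY Mx; rewrite FX ?GY].
rewrite (mdiffE tu e) (mdiffE tu eF) (mdiffE tu eG) (@diff_val _ _ _ _ _ _ _ D).
by rewrite (nbhs_singleton FX Mp) (nbhs_singleton GY Mp).
Qed.

Lemma mdiff_cst {V : normedModType R} M (c : V) p u :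
  tangent_vec M p u -> mdiff M (fun=> c) p u = 0.
Proof.
move=> tu; have e : extends_at M p (fun=> c) (cst c).
  exact: extends_on (differentiable_cst _ _) _.
by rewrite (mdiffE tu e) diff_cst.
Qed.

Lemma mdiff_mink M X Y p u (c : R) :
    smooth_on M X -> smooth_on M Y -> M p -> tangent_vec M p u ->
    (forall x, M x -> mink (X x) (Y x) = c) ->
  mink (mdiff M X p u) (Y p) + mink (X p) (mdiff M Y p u) = 0.
Proof.
move=> sX sY Mp tu XY.
have := mdiff_bilinear (@mink R : {bilinear _ -> _ -> R^o}) sX sY Mp tu.
by rewrite (mdiff_eq_on p u XY) mdiff_cst // addrC => <-.
Qed.

Lemma mdiff_wedge M X Y p u :
    smooth_on M X -> smooth_on M Y -> M p -> tangent_vec M p u ->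
  mdiff M (fun x => wedge (X x) (Y x)) p u
    = wedge (mdiff M X p u) (Y p) + wedge (X p) (mdiff M Y p u).
Proof. by move=> sX sY Mp tu; rewrite (mdiff_bilinear (@wedge R)) // addrC. Qed.

Lemma smooth_on_lin {V : normedModType R} M (f g : 'rV[R]_4 -> V) (a b : R) :
  smooth_on M f -> smooth_on M g -> smooth_on M (fun x => a *: f x + b *: g x).
Proof.
move=> sf sg p Mp.
have [D [F [Dop Dp sF eF]]] := sf p Mp; have [E [G [Eop Ep sG eG]]] := sg p Mp.
exists (D `&` E), (a *: F + b *: G); split=> //.
- exact: openI.
- have oI : open (D `&` E) by exact: openI.
  move=> k; apply: ckD => //; apply: ckZ => //.
    by apply: ck_sub (sF k) => x [].
  by apply: ck_sub (sG k) => x [].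
- by move=> x [Dx Ex] Mx; rewrite !fctE eF ?eG.
Qed.

Lemma smooth_on_linear {V : normedModType R} M (l : {linear 'rV[R]_4 -> V}) :
  smooth_on M l.
Proof.
move=> p _; exists setT, l; split=> //; first exact: openT.
by apply: smooth_linear; exact: rV_linear_continuous.
Qed.

Lemma lie_linear M Y p (l : {linear 'rV[R]_4 -> R^o}) :
  tangent_vec M p (Y p) -> lie M Y l p = l (Y p).
Proof.
move=> tY; have cl := @rV_linear_continuous _ _ _ l.
have e : extends_at M p l l.
  by apply: extends_on => //; exact: linear_differentiable.
by rewrite /lie (mdiffE tY e) diff_lin.
Qed.

(** The torsion axiom speaks of derivations; applied to the i-th coordinate
    function, along which a field Y differentiates to its i-th component, it yields
    the i-th component of the bracket of X and Y as a difference of derivatives. *)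
Lemma torsion_free M nabla X Y p :
    levi_civita M nabla -> tangent_field M X -> tangent_field M Y -> M p ->
  nabla X Y p - nabla Y X p = mdiff M Y p (X p) - mdiff M X p (Y p).
Proof.
case=> tn _ _ _ tor tX tY Mp; apply/rowP => i.
have lc : linear (fun x : 'rV[R]_4 => x 0 i : R^o) by move=> a u v; rewrite !mxE.
pose l : {linear 'rV[R]_4 -> R^o} :=
  HB.pack (fun x : 'rV[R]_4 => x 0 i : R^o) (GRing.isLinear.Build _ _ _ _ _ lc).
have lieE X' Y' : tangent_field M X' -> tangent_field M Y' ->
    lie M X' (lie M Y' l) p = l (mdiff M Y' p (X' p)).
  move=> [_ tX'] [sY' tY']; rewrite -(mdiff_linear l) //; last exact: tX'.
  by apply: mdiff_eq_on => x Mx; rewrite lie_linear //; exact: tY'.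
have [_ tXY] := tn X Y tX tY; have [_ tYX] := tn Y X tY tX.
have := tor X Y l p tX tY (smooth_on_linear l) Mp.
by rewrite !lieE // (lie_linear _ (tXY p Mp)) (lie_linear _ (tYX p Mp)) !mxE.
Qed.

(** The difference of the two derivatives is the bracket of X and Y, which the
    absence of torsion makes tangent. *)
Lemma second_form_sym M nabla X Y nu p :
    levi_civita M nabla -> tangent_field M X -> tangent_field M Y ->
    normal_vec M p nu -> M p ->
  mink (mdiff M Y p (X p)) nu = mink (mdiff M X p (Y p)) nu.
Proof.
move=> hn tX tY nnu Mp; have [tn _ _ _ _] := hn.
apply/eqP; rewrite -subr_eq0 -minkNl -minkDl -(torsion_free hn) // minkDl minkNl.
have [_ tXY] := tn X Y tX tY; have [_ tYX] := tn Y X tY tX.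
by rewrite (nnu _ (tXY p Mp)) (nnu _ (tYX p Mp)) subrr.
Qed.

(** The Levi-Civita part of the second fundamental form is tangent, so it
    disappears in the product with a normal vector. *)
Lemma shape_operatorE M nabla A nu X Y p :
    levi_civita M nabla -> shape_operator M nabla A ->
    normal_field M nu -> tangent_field M X -> tangent_field M Y -> M p ->
  mink (A nu X p) (Y p) = mink (mdiff M Y p (X p)) (nu p).
Proof.
move=> [tn _ _ _ _] hA nnu tX tY Mp; have [_ ->] := hA nu X nnu tX; rewrite //.
rewrite /second_form /flat_nabla minkDl minkNl.
have [_ tXY] := tn X Y tX tY; have [_ nn] := nnu.
by rewrite (nn p Mp _ (tXY p Mp)) subr0.
Qed.

Lemma normal_field_lin M X Y (a b : R) :
  normal_field M X -> normal_field M Y ->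
  normal_field M (fun x => a *: X x + b *: Y x).
Proof.
move=> [sX nX] [sY nY]; split; first exact: smooth_on_lin.
by move=> p Mp u tu; rewrite minkDr !minkZr nX ?nY // !mulr0 addr0.
Qed.

End Tangential.

(** * Orthonormal tangent frames *)

Section OrthonormalFrame.
Context {R : realType}.
Implicit Types (M : set 'rV[R]_4) (X Y : 'rV[R]_4 -> 'rV[R]_4).

Lemma tangent_expand M p x w v :
    tangent_basis M p x w -> mink x x = 1 -> mink w w = 1 -> mink x w = 0 ->
    tangent_vec M p v ->
  v = mink v x *: x + mink v w *: w.
Proof.
move=> [_ bas] xx ww xw /bas[a [b ->]].
by rewrite !minkDl !minkZl (minkC w x) xx ww xw !mulr0 !mulr1 addr0 add0r.
Qed.

(** The basis chosen by the Gauss map is obtained from (x, w) by an orthogonal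
    matrix; its determinant is positive because both bases are, and its square is
    1 by the identity of Lagrange. *)
Lemma gauss_map_wedge M pos G p x w :
    orientation M pos -> gauss_map M pos G -> M p -> pos p x w ->
    mink x x = 1 -> mink w w = 1 -> mink x w = 0 ->
  G p = wedge x w.
Proof.
move=> [hbas hdet _] hG Mp pxw xx ww xw.
have [u1 [u2 [pu uu1 uu2 u12 ->]]] := hG p Mp.
have [_ bas] := hbas p u1 u2 Mp pu; have xwbas := hbas p x w Mp pxw.
have tu1 : tangent_vec M p u1 by apply/bas; exists 1, 0; rewrite scale1r scale0r addr0.
have tu2 : tangent_vec M p u2 by apply/bas; exists 0, 1; rewrite scale1r scale0r add0r.
move: pu uu1 uu2 u12.
rewrite (tangent_expand xwbas xx ww xw tu1) (tangent_expand xwbas xx ww xw tu2).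
set a := mink u1 x; set b := mink u1 w; set c := mink u2 x; set d := mink u2 w.
move=> /(hdet p x w a b c d Mp pxw) adbc.
rewrite !minkDl !minkDr !minkZl !minkZr (minkC w x) xx ww xw => ab cd abcd.
suff -> : wedge (a *: x + b *: w) (c *: x + d *: w) = 1 *: wedge x w by rewrite scale1r.
rewrite wedgeDD; congr (_ *: _); apply/eqP; rewrite -(@pexpr_eq1 _ _ 2) //; last exact: ltW.
have -> : (a * d - b * c) ^+ 2 = (a * a + b * b) * (c * c + d * d) - (a * c + b * d) ^+ 2.
  by ring.
have -> : a * a + b * b = 1 by rewrite -ab; ring.
have -> : c * c + d * d = 1 by rewrite -cd; ring.
have -> : a * c + b * d = 0 by rewrite -abcd; ring.
by rewrite expr0n subr0 mulr1.
Qed.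

(** Expanding A_nu X in the orthonormal frame (X, Y) turns a product of two shape
    operators into products of entries of the second fundamental form. *)
Lemma shape_operator_comp M nabla A (mu nu : 'rV[R]_4 -> 'rV[R]_4) X Y p :
    levi_civita M nabla -> shape_operator M nabla A ->
    normal_field M mu -> normal_field M nu ->
    tangent_field M X -> tangent_field M Y -> M p ->
    tangent_basis M p (X p) (Y p) ->
    mink (X p) (X p) = 1 -> mink (Y p) (Y p) = 1 -> mink (X p) (Y p) = 0 ->
  mink (A mu (A nu X) p) (Y p) =
    mink (mdiff M X p (X p)) (nu p) * mink (mdiff M Y p (X p)) (mu p)
    + mink (mdiff M Y p (X p)) (nu p) * mink (mdiff M Y p (Y p)) (mu p).
Proof.
move=> hn hA nmu nnu tX tY Mp bas XX YY XY.
have [tAX _] := hA nu X nnu tX.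
have [[sX tXp] [sY tYp] [_ tAXp]] := And3 tX tY tAX.
have E := tangent_expand bas XX YY XY (tAXp p Mp).
rewrite (shape_operatorE hn hA) // E mdiff_lin -?E //; [|exact: tXp|exact: tYp|exact: tAXp].
by rewrite minkDl !minkZl !(shape_operatorE hn hA nnu).
Qed.

(** The tangent components of the derivatives of X and Y drop out of the wedge
    with X /\ Y; the condition says that their components in the normal plane are
    proportional. *)
Lemma delta_null_frame M G X Y p u (n m : 'rV[R]_4) :
    smooth_on M X -> smooth_on M Y -> M p -> tangent_vec M p u ->
    (forall x, M x -> G x = wedge (X x) (Y x)) ->
    mink (X p) (X p) = 1 -> mink (Y p) (Y p) = 1 -> mink (X p) (Y p) = 0 ->
    mink (X p) n = 0 -> mink (X p) m = 0 -> mink (Y p) n = 0 -> mink (Y p) m = 0 ->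
    mink n n = 0 -> mink m m = 0 -> mink n m = 1 ->
  delta M G p u = 0 <->
    mink (mdiff M X p u) n * mink (mdiff M Y p u) m
      = mink (mdiff M X p u) m * mink (mdiff M Y p u) n.
Proof.
move=> sX sY Mp tu GE XX YY XY Xn Xm Yn Ym nn mm nm.
have plane s t := wedge4_normal_plane s t XX YY XY Xn Xm Yn Ym.
pose V := wedge4 (wedge (X p) (Y p)) (wedge n m).
(* V is the volume of the frame (X, Y, n, m), namely 1 or -1. *)
have V2 : V * V = 1 by rewrite plane nn mm (minkC m) nm mulr1 mulr0 subr0.
have Vn0 : V != 0 by apply: contra_eq_neq V2 => ->; rewrite mulr0 eq_sym oner_eq0.
set s := mdiff M X p u; set t := mdiff M Y p u.
have E : delta M G p u * V = 2 * (mink s n * mink t m - mink s m * mink t n).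
  rewrite /delta (mdiff_eq_on p u GE) mdiff_wedge // wedge4_sum mulNr -mulrA plane.
  by rewrite -mulrN opprB.
split=> H.
  by move/eqP: E; rewrite H mul0r eq_sym mulf_eq0 pnatr_eq0 subr_eq0 => /eqP.
by move/eqP: E; rewrite H subrr mulr0 mulf_eq0 (negPf Vn0) orbF => /eqP.
Qed.

(** With nu and nu' the sum and the difference of N and N' over sqrt 2, the
    commutator of A_nu and A_nu' is that of A_N' and A_N: the squares cancel and
    the mixed terms come twice, which compensates the two factors 1 / sqrt 2. *)
Lemma normal_curvature_null_frame M nabla A X Y (N N' : 'rV[R]_4 -> 'rV[R]_4) p :
    levi_civita M nabla -> shape_operator M nabla A ->
    normal_field M N -> normal_field M N' ->
    tangent_field M X -> tangent_field M Y -> M p ->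
    tangent_basis M p (X p) (Y p) ->
    mink (X p) (X p) = 1 -> mink (Y p) (Y p) = 1 -> mink (X p) (Y p) = 0 ->
  normal_curvature A X N Y N' p =
    mink (mdiff M X p (X p)) (N p) * mink (mdiff M Y p (X p)) (N' p)
    + mink (mdiff M Y p (X p)) (N p) * mink (mdiff M Y p (Y p)) (N' p)
    - mink (mdiff M X p (X p)) (N' p) * mink (mdiff M Y p (X p)) (N p)
    - mink (mdiff M Y p (X p)) (N' p) * mink (mdiff M Y p (Y p)) (N p).
Proof.
move=> hn hA nN nN' tX tY Mp bas XX YY XY.
have ne3 : normal_field M (e3 N N').
  have -> : e3 N N' = fun p => (Num.sqrt 2)^-1 *: N p + (Num.sqrt 2)^-1 *: N' p.
    by apply/funext => q; rewrite /e3 scalerDr.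
  exact: normal_field_lin.
have ne4 : normal_field M (e4 N N').
  have -> : e4 N N' = fun p => (Num.sqrt 2)^-1 *: N p + (- (Num.sqrt 2)^-1) *: N' p.
    by apply/funext => q; rewrite /e4 scalerBr scaleNr.
  exact: normal_field_lin.
rewrite /normal_curvature minkDl minkNl.
rewrite (shape_operator_comp hn hA ne3 ne4 tX tY Mp bas XX YY XY).
rewrite (shape_operator_comp hn hA ne4 ne3 tX tY Mp bas XX YY XY).
rewrite /e3 /e4 !minkZr !minkDr !minkNr.
have c2 : (Num.sqrt 2)^-1 * (Num.sqrt 2)^-1 * 2 = 1 :> R.
  by rewrite -invfM -expr2 sqr_sqrtr ?ler0n // mulVf ?pnatr_eq0.
rewrite -[RHS]mul1r -[X in _ = X * _]c2.
by ring.
Qed.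

End OrthonormalFrame.

(** * Canonical normal null directions *)


Theorem proposition2p12 (R : realType) (M : set 'rV[R]_4)
    (pos : 'rV[R]_4 -> 'rV[R]_4 -> 'rV[R]_4 -> Prop)
    (nabla A : ('rV[R]_4 -> 'rV[R]_4) -> ('rV[R]_4 -> 'rV[R]_4) ->
               'rV[R]_4 -> 'rV[R]_4)
    (z : 'rV[R]_4) (Zt Zn W W' : 'rV[R]_4 -> 'rV[R]_4)
    (G : 'rV[R]_4 -> 'M[R]_4)
    (hM : smooth_surface M) (hspacelike : spacelike M)
    (hpos : orientation M pos)
    (hnabla : levi_civita M nabla) (hA : shape_operator M nabla A)
    (hz : mink z z = 1) (hparts : parallel_parts M z Zt Zn)
    (hnull : lightlike_normal M Zn)
    (hW : tangent_field M W)
    (hWunit : forall p, M p ->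
       [/\ mink (W p) (W p) = 1, mink (Zt p) (W p) = 0 & pos p (Zt p) (W p)])
    (hW' : lightlike_normal M W')
    (hW'dual : forall p, M p -> mink (Zn p) (W' p) = 1)
    (hframe : forall p, M p ->
       positive_frame (Zt p) (W p) (e3 Zn W' p) (e4 Zn W' p))
    (hG : gauss_map M pos G) :
  (forall p, M p -> asymptotic M G p (Zt p)) /\
  ((forall p, M p -> asymptotic M G p (W p)) <->
   (forall p, M p -> normal_curvature A Zt Zn W W' p = 0)).
Proof.
have [hZt hZn zE] := hparts; have [sZt tZt] := hZt; have [sZn nZn] := hZn.
have [sW tW] := hW; have [hW'n W'null] := hW'; have [_ nW'] := hW'n.
have [_ Znull] := hnull.
have nn p (Mp : M p) : mink (Zn p) (Zn p) = 0 by have [] := Znull p Mp.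
have mm p (Mp : M p) : mink (W' p) (W' p) = 0 by have [] := W'null p Mp.
have xn p (Mp : M p) : mink (Zt p) (Zn p) = 0 by exact: nZn (tZt p Mp).
have xx p (Mp : M p) : mink (Zt p) (Zt p) = 1.
  move: hz; rewrite (zE p Mp) minkDl !minkDr (minkC (Zn p) (Zt p)) xn // nn //.
  by rewrite !addr0.
have ww p (Mp : M p) : mink (W p) (W p) = 1 by have [] := hWunit p Mp.
have xw p (Mp : M p) : mink (Zt p) (W p) = 0 by have [] := hWunit p Mp.
have pxw p (Mp : M p) : pos p (Zt p) (W p) by have [] := hWunit p Mp.
have bas p (Mp : M p) : tangent_basis M p (Zt p) (W p).
  by have [b _ _] := hpos; exact: b (pxw p Mp).
have GE p (Mp : M p) : G p = wedge (Zt p) (W p).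
  exact: gauss_map_wedge hpos hG Mp (pxw p Mp) (xx p Mp) (ww p Mp) (xw p Mp).
(* z is constant and its normal part is null, whence <D_u Zn, Zn> = 0. *)
have dZtn p u : M p -> tangent_vec M p u -> mink (mdiff M Zt p u) (Zn p) = 0.
  move=> Mp tu; have := mdiff_mink sZn sZn Mp tu nn.
  rewrite (mdiffN_cst sZt Mp tu zE) minkNl minkNr (minkC (Zn p)) => /eqP.
  by rewrite -opprD oppr_eq0 -mulr2n mulrn_eq0 => /eqP.
have dWn p : M p -> mink (mdiff M W p (Zt p)) (Zn p) = 0.
  move=> Mp; rewrite (second_form_sym hnabla hZt hW) ?dZtn //; first exact: tW.
  by move=> u; exact: nZn.
have delta0 p u : M p -> tangent_vec M p u -> delta M G p u = 0 <->
    mink (mdiff M Zt p u) (W' p) * mink (mdiff M W p u) (Zn p) = 0.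
  move=> Mp tu; have tX := tZt p Mp; have tY := tW p Mp.
  rewrite (delta_null_frame sZt sW Mp tu GE (xx p Mp) (ww p Mp) (xw p Mp) (xn p Mp)
    (nW' p Mp _ tX) (nZn p Mp _ tY) (nW' p Mp _ tY) (nn p Mp) (mm p Mp) (hW'dual p Mp)).
  by rewrite dZtn // mul0r; split=> ->.
have KN p : M p -> normal_curvature A Zt Zn W W' p =
    - (mink (mdiff M Zt p (W p)) (W' p) * mink (mdiff M W p (W p)) (Zn p)).
  move=> Mp.
  rewrite (normal_curvature_null_frame hnabla hA hZn hW'n hZt hW Mp (bas p Mp)
    (xx p Mp) (ww p Mp) (xw p Mp)).
  rewrite dWn // (dZtn p _ Mp (tZt p Mp)) mulr0 !mul0r subr0 addr0 add0r.
  by rewrite (second_form_sym hnabla hZt hW) // => u; exact: nW'.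
have neq0 v : mink v v = 1 -> v != 0 :> 'rV[R]_4.
  by move=> vv; apply: contra_eq_neq vv => ->; rewrite mink0l eq_sym oner_eq0.
split=> [p Mp|].
  split; [exact: tZt|exact: neq0 (xx p Mp)|apply/(delta0 p _ Mp (tZt p Mp))].
  by rewrite dWn // mulr0.
split=> H p Mp.
  have [_ _ /(delta0 p _ Mp (tW p Mp)) lm0] := H p Mp.
  by rewrite KN // lm0 oppr0.
split; [exact: tW|exact: neq0 (ww p Mp)|apply/(delta0 p _ Mp (tW p Mp))].
by apply/eqP; rewrite -oppr_eq0 -KN // H.
Qed.
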